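(* Let $\mathbf{A} \in \mathbb{C}^{p\times p}$ be a nonzero positive semidefinite matrix, let $\alpha = \tfrac{q}{p} \in (0,\infty)$, and for $\lambda \in (\lambda_0, \infty)$ let $\mu(\lambda)$ be the unique solution in $(\mu_0, \infty)$ to $$\lambda = \mu \left(1 - \tfrac{1}{q} \operatorname{tr}\left[\mathbf{A} (\mathbf{A} + \mu \mathbf{I}_p)^{-1}\right]\right).$$ The function $\lambda \mapsto \mu(\lambda)$ is a concave function over $(\lambda_0, \infty)$. Furthermore, for any $\alpha \in (0, \infty)$, $\mu(\lambda) \le \lambda + \tfrac{1}{q} \operatorname{tr}[\mathbf{A}]$ for all $\lambda \in (\lambda_0, \infty)$; and when $\alpha \le r(\mathbf{A})$, $\mu(\lambda) \ge \lambda$ for all $\lambda \in (\lambda_0, \infty)$, otherwise $\mu(\lambda) \ge \lambda$ for $\lambda \ge 0$. Additionally, $\lim_{\lambda \nearrow \infty} \left|\mu(\lambda) - \left(\lambda + \tfrac{1}{q} \operatorname{tr}[\mathbf{A}]\right)\right| = 0$.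
   Context: $r(\mathbf{A}) = \tfrac{1}{p}\operatorname{rank}(\mathbf{A})$; $\lambda_{\min}^{+}(\mathbf{A})$ is the smallest positive eigenvalue of $\mathbf{A}$. The quantities $\mu_0, \lambda_0 \in \mathbb{R}$ are the unique solutions, satisfying $\mu_0 > -\lambda_{\min}^{+}(\mathbf{A})$, to $$1 = \tfrac{1}{q} \operatorname{tr}\left[\mathbf{A}^2 (\mathbf{A} + \mu_0 \mathbf{I}_p)^{-2}\right], \qquad \lambda_0 = \mu_0 \left(1 - \tfrac{1}{q} \operatorname{tr}\left[\mathbf{A} (\mathbf{A} + \mu_0 \mathbf{I}_p)^{-1}\right]\right).$$ When $\mathbf{A}$ is singular, $\mathbf{A}(\mathbf{A}+x\mathbf{I}_p)^{-1}$ and its square at $x = 0$ are understood by continuous extension (i.e. zero eigenvalues of $\mathbf{A}$ contribute $0$). *)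

(* Defs.v *)
From mathcomp Require Import all_boot all_order all_algebra.
From mathcomp Require Import spectral complex.
From mathcomp Require Import all_classical all_reals all_analysis.

Set Implicit Arguments.
Unset Strict Implicit.
Unset Printing Implicit Defensive.

Import Order.TTheory GRing.Theory Num.Theory.
Import numFieldNormedType.Exports.

Local Open Scope classical_set_scope.
Local Open Scope ring_scope.
Local Open Scope complex_scope.
Local Open Scope sesquilinear_scope.

Section Definitions.
Variable R : realType.

(* In the order of R[i], [0 <= z] says that z is real and nonnegative. *)
Definition psdmx p (A : 'M[R[i]]_p) : Prop :=
  A \is hermsymmx /\ forall v : 'cV[R[i]]_p, 0 <= (v ^t* *m A *m v) 0 0.

Definition rank_ratio p (A : 'M[R[i]]_p) : R := (\rank A)%:R / p%:R.

Definition positive_eigenvalues p (A : 'M[R[i]]_p) : set R :=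
  [set l | 0 < l /\ eigenvalue A l%:C].

Definition lambda_min_pos p (A : 'M[R[i]]_p) : R :=
  get (positive_eigenvalues A `&` lbound (positive_eigenvalues A)).

(* A (A + x I)^-1, extended by continuity in the real parameter x to the
   points where A + x I is singular (in particular x = 0 when A is singular,
   where [invmx] alone would give a wrong value). The ascription to
   [numFieldType] selects the topology of R[i]. *)
Definition resolvent_mul p (A : 'M[R[i]]_p) (x : R) : 'M[R[i]]_p :=
  if A + (x%:C)%:M \in unitmx then A *m invmx (A + (x%:C)%:M)
  else lim ((A *m invmx (A + (y%:C)%:M) : 'M[R[i] : numFieldType]_p)
              @[y --> x^']).

(* The equations below are between complex numbers; [get] picks their unique
   real solution in the indicated range. *)
Definition mu0 p (A : 'M[R[i]]_p) (q : R) : R :=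
  get [set m : R | - lambda_min_pos A < m /\
    1 = (q%:C)^-1 * \tr (resolvent_mul A m *m resolvent_mul A m)].

Definition lambda_eq p (A : 'M[R[i]]_p) (q l m : R) : Prop :=
  l%:C = m%:C * (1 - (q%:C)^-1 * \tr (resolvent_mul A m)).

Definition lambda0 p (A : 'M[R[i]]_p) (q : R) : R :=
  get [set l : R | lambda_eq A q l (mu0 A q)].

(* Meaningful for [lambda0 A q < l] only. *)
Definition mu p (A : 'M[R[i]]_p) (q l : R) : R :=
  get [set m : R | mu0 A q < m /\ lambda_eq A q l m].

Definition concave_function (D : set R) (f : R -> R) : Prop :=
  convex_function D (fun x => - f x).

End Definitions.

(* Main.v *)
(* Let d_i >= 0 be the eigenvalues of A.
   Since x d / (d + x) = d - d^2 / (d + x), the equation defining mu reads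
   lambda = f(mu) with
     f(x) = x - tr(A)/q + 1/q \sum_i d_i^2 / (d_i + x),
   which is convex, and f'(mu0) = 0, so f is increasing and convex on
   [mu0, +oo[; hence its inverse mu is concave. The upper bound and the
   asymptote come from the sign and the decay of the last sum, and
   mu(lambda) >= lambda whenever mu(lambda) >= 0. Finally q <= rank A is
   equivalent to mu0 >= 0, because \sum_i (d_i / (d_i + x))^2 decreases in x and
   is the rank at 0. *)
Require Import Defs.
From mathcomp Require Import all_boot all_order all_algebra.
From mathcomp Require Import complex spectral ring lra.
From mathcomp Require Import all_classical all_reals all_analysis.
Import Order.TTheory GRing.Theory Num.Theory.
Import numFieldNormedType.Exports.
Local Open Scope classical_set_scope.
Local Open Scope ring_scope.
Local Open Scope complex_scope.
Set Implicit Arguments.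
Unset Strict Implicit.
Unset Printing Implicit Defensive.

(** * Scalar analysis of the secular function of nonnegative weights *)

Section SecularFunction.
Context {R : realType} {n : nat} (d : 'I_n -> R) (q : R).

(** Right-hand side of the equation for [mu], with the weights [d] as eigenvalues. Division by zero
    yields 0, so a zero weight contributes 0 even at [x = 0], as the continuous extension
    requires. *)
Definition secular (x : R) : R := x * (1 - q^-1 * \sum_i d i / (d i + x)).

(** For eigenvalues [d] this is tr[A^2 (A + x I)^-2]; the derivative of [secular] is
    [1 - q^-1 * sqsum x]. *)
Definition sqsum (x : R) : R := \sum_i (d i / (d i + x)) ^+ 2.

(** Stands for [- lambda_min_pos A < x]. Only positive weights are constrained, so 0 is always
    admissible. *)
Definition admissible (x : R) : Prop := forall i, 0 < d i -> 0 < d i + x.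

Lemma admissible_le x y : x <= y -> admissible x -> admissible y.
Proof. by move=> xy xd i /xd; lra. Qed.

Lemma near_admissible x : admissible x -> \forall y \near x, admissible y.
Proof.
move=> xd; near=> y => i; move: i; near: y; apply: filter_forall => i.
have [/xd dx|] := boolP (0 < d i); last by move=> _; near=> y.
near=> y => _; near: y.
apply: (@cvgr_gt _ _ (nbhs x) _ (fun y => d i + y) (d i + x)) => //.
by apply: cvgD; [exact: cvg_cst|exact: cvg_id].
Unshelve. all: by end_near. Qed.

Context (d_ge0 : forall i, 0 <= d i).

Lemma weight_eq0_or_gt0 i : d i = 0 \/ 0 < d i.
Proof.
by have := d_ge0 i; rewrite le_eqVlt => /predU1P[<-|]; [left|right].
Qed.

Lemma secularE x : admissible x ->
  secular x = x - q^-1 * \sum_i d i + q^-1 * \sum_i d i ^+ 2 / (d i + x).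
Proof.
move=> xd; rewrite /secular mulrBr mulr1 mulrCA -addrA; congr (_ + _).
rewrite addrC -mulrBr -mulrN; congr (_ * _).
rewrite -sumrB mulr_sumr -sumrN; apply: eq_bigr => i _.
have [->|/xd dx] := weight_eq0_or_gt0 i.
  by rewrite expr2 !mul0r mulr0; ring.
by field; rewrite gt_eqF.
Qed.

(** A divided difference that replaces the derivative: at [y = x] the second factor becomes
    [1 - q^-1 * sqsum x]. *)
Lemma secularB x y : admissible x -> admissible y ->
  secular y - secular x =
  (y - x) * (1 - q^-1 * \sum_i d i ^+ 2 / ((d i + x) * (d i + y))).
Proof.
move=> xd yd; rewrite !secularE//.
transitivity ((y - x) + q^-1 *
    (\sum_i d i ^+ 2 / (d i + y) - \sum_i d i ^+ 2 / (d i + x))); first by ring.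
rewrite [RHS]mulrBr mulr1; congr (_ + _); rewrite mulrCA -mulrN; congr (_ * _).
rewrite -sumrB mulr_sumr -sumrN; apply: eq_bigr => i _.
have [->|di] := weight_eq0_or_gt0 i.
  by rewrite expr2 !mul0r mulr0; ring.
by field; rewrite !gt_eqF ?xd ?yd.
Qed.

Lemma secular_convex (x y t : R) : 0 <= q -> admissible x -> admissible y ->
  0 <= t <= 1 ->
  secular (t * x + (1 - t) * y) <= t * secular x + (1 - t) * secular y.
Proof.
move=> q0 xd yd /andP[t0 t1].
have zd : admissible (t * x + (1 - t) * y).
  move=> i di; have := xd i di; have := yd i di; move: (d i) => e ey ex.
  have [->|tn0] := eqVneq t 0; first by lra.
  have -> : e + (t * x + (1 - t) * y) = t * (e + x) + (1 - t) * (e + y) by ring.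
  apply: ltr_pwDl; first by rewrite mulr_gt0// lt0r tn0.
  by rewrite mulr_ge0 ?subr_ge0// ltW.
rewrite !secularE//.
suff : \sum_i d i ^+ 2 / (d i + (t * x + (1 - t) * y)) <=
    t * \sum_i d i ^+ 2 / (d i + x) + (1 - t) * \sum_i d i ^+ 2 / (d i + y).
  by rewrite -invr_ge0 in q0; move/(ler_wpM2l q0); lra.
rewrite !mulr_sumr -big_split; apply: ler_sum => i _ /=.
have [->|di] := weight_eq0_or_gt0 i; first by rewrite expr2 !mul0r !mulr0 addr0.
rewrite mulrCA (mulrCA (1 - t)) -mulrDr ler_wpM2l ?exprn_ge0//.
have := zd i di; have := xd i di; have := yd i di.
have -> : d i + (t * x + (1 - t) * y) = t * (d i + x) + (1 - t) * (d i + y).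
  by ring.
move: (d i + x) (d i + y) => u v v0 u0 w0.
rewrite -subr_ge0.
(* The convexity defect of the inverse in closed form: its sign can be read off the factors. *)
have -> : t / u + (1 - t) / v - (t * u + (1 - t) * v)^-1 =
    t * (1 - t) * (u - v) ^+ 2 / (u * v * (t * u + (1 - t) * v)).
  by field; rewrite !gt_eqF.
apply: divr_ge0; last by rewrite !mulr_ge0// ltW.
by apply: mulr_ge0; [rewrite mulr_ge0 ?subr_ge0|exact: sqr_ge0].
Qed.

Lemma ratio_continuous i x : admissible x ->
  {for x, continuous (fun y => d i / (d i + y))}.
Proof.
move=> xd; have [->|/xd dx] := weight_eq0_or_gt0 i.
  rewrite (_ : (fun _ => _) = fun=> 0); first exact: cvg_cst.
  by apply/funext => y; rewrite mul0r.
apply: cvgM; first exact: cvg_cst.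
apply: cvgV; first by rewrite gt_eqF.
by apply: cvgD; [exact: cvg_cst|exact: cvg_id].
Qed.

Lemma secular_continuous x : admissible x -> {for x, continuous secular}.
Proof.
move=> xd; apply: cvgM; first exact: cvg_id.
apply: cvgB; first exact: cvg_cst.
apply: cvgM; first exact: cvg_cst.
apply: cvg_big => [|i _]; first exact: add_continuous.
exact: ratio_continuous.
Qed.

Lemma sqsum_continuous x : admissible x -> {for x, continuous sqsum}.
Proof.
move=> xd; apply: cvg_big => [|i _]; first exact: add_continuous.
by apply: cvgM; exact: ratio_continuous.
Qed.

Context (i0 : 'I_n) (di0 : 0 < d i0).

Lemma sqsum_lt x y : admissible x -> x < y -> sqsum y < sqsum x.
Proof.
move=> xd xy; have yd : admissible y := admissible_le (ltW xy) xd.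
have lt_term i : 0 < d i -> (d i / (d i + y)) ^+ 2 < (d i / (d i + x)) ^+ 2.
  move=> di; rewrite ltrXn2r// ?nnegrE ?divr_ge0 ?(ltW di) ?ltW ?xd ?yd//.
  by rewrite ltr_pM2l// ltf_pV2 ?posrE ?xd ?yd// ltrD2l.
rewrite /sqsum (bigD1 i0)//= [ltRHS](bigD1 i0)//= ltr_leD ?lt_term//.
apply: ler_sum => i _; have [->|/lt_term/ltW//] := weight_eq0_or_gt0 i.
by rewrite !mul0r.
Qed.

Lemma sqsum_surj (m : R) : 0 < q -> (forall i, 0 < d i -> m <= d i) ->
  0 < m -> (exists i, d i = m) -> exists2 x, - m < x & sqsum x = q.
Proof.
move=> q0 mle m0 [i1 i1m].
have adm x : - m < x -> admissible x by move=> mx i /mle; lra.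
(* Chosen so that the ratio of the smallest positive weight is [q + 1], whose square already exceeds
   [q]. *)
pose a := - m + m / (q + 1).
have ma : - m < a by rewrite ltrDl divr_gt0// addr_gt0.
have s0 : 0 < \sum_i d i.
  by rewrite (bigD1 i0)//= ltr_pwDl// sumr_ge0.
(* Each squared ratio at [b] is at most [d i / b], and these bounds add up to exactly [q]. *)
pose b := (\sum_i d i) / q.
have b0 : 0 < b by rewrite divr_gt0.
have a0 : a < 0.
  rewrite /a addrC subr_lt0 ltr_pdivrMr ?addr_gt0//.
  by rewrite mulrDr mulr1 ltrDr mulr_gt0.
have qa : q <= sqsum a.
  rewrite /sqsum (bigD1 i1)//= i1m.
  have -> : m / (m + a) = q + 1.
    by rewrite /a addrA subrr add0r; field; rewrite !gt_eqF ?addr_gt0.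
  by apply: ler_wpDr; [apply: sumr_ge0 => i _; exact: sqr_ge0|nra].
have bq : sqsum b <= q.
  have <- : \sum_i d i / b = q.
    by rewrite -mulr_suml /b; field; rewrite !gt_eqF.
  apply: ler_sum => i _; have [->|di] := weight_eq0_or_gt0 i.
    by rewrite !mul0r expr2 mul0r.
  have db : 0 < d i + b by rewrite addr_gt0.
  rewrite -subr_ge0.
  have -> : d i / b - (d i / (d i + b)) ^+ 2 =
      d i * (d i ^+ 2 + d i * b + b ^+ 2) / (b * (d i + b) ^+ 2).
    by field; rewrite !gt_eqF.
  have [dw bw] := (ltW di, ltW b0); apply: divr_ge0.
    by rewrite mulr_ge0// !addr_ge0 ?exprn_ge0// mulr_ge0.
  by rewrite mulr_ge0 ?sqr_ge0.
have ab : a <= b by exact: ltW (lt_trans a0 b0).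
have [||c] := @IVT R sqsum a b q ab.
- apply: continuous_in_subspaceT => x.
  rewrite inE/= in_itv/= => /andP[ax _].
  by apply: sqsum_continuous; apply: adm; exact: lt_le_trans ax.
- by rewrite ge_min bq orbT/= le_max qa.
rewrite in_itv/= => /andP[ac _] cq; exists c => //.
exact: lt_le_trans ac.
Qed.

(* The divided difference of [secular] is at least its derivative at [m0],
   which vanishes. *)
Lemma secular_lt m0 x y : 0 < q -> admissible m0 -> sqsum m0 = q ->
  m0 <= x -> x < y -> secular x < secular y.
Proof.
move=> q0 m0d m0q m0x xy; have xd := admissible_le m0x m0d.
have yd := admissible_le (ltW xy) xd.
rewrite -subr_gt0 secularB// mulr_gt0 ?subr_gt0//.
rewrite ltr_pdivrMl// mulr1 -[ltRHS]m0q.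
have lt_term i : 0 < d i ->
    d i ^+ 2 / ((d i + x) * (d i + y)) < (d i / (d i + m0)) ^+ 2.
  move=> di; rewrite exprMn exprVn ltr_pM2l ?exprn_gt0//.
  rewrite ltf_pV2 ?posrE ?mulr_gt0 ?exprn_gt0 ?m0d ?xd ?yd// expr2.
  apply: le_lt_trans (_ : _ <= (d i + x) * (d i + m0)) _.
    by rewrite ler_pM2r ?m0d// lerD2l.
  by rewrite ltr_pM2l ?xd// ltrD2l; exact: le_lt_trans xy.
rewrite /sqsum (bigD1 i0)//= [ltRHS](bigD1 i0)//= ltr_leD ?lt_term//.
apply: ler_sum => i _; have [->|/lt_term/ltW//] := weight_eq0_or_gt0 i.
by rewrite expr2 !mul0r expr2 mul0r.
Qed.

Lemma secular_ge x : 0 < q -> admissible x ->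
  x - q^-1 * \sum_i d i <= secular x.
Proof.
move=> q0 xd; rewrite secularE// lerDl mulr_ge0 ?invr_ge0 ?(ltW q0)//.
apply: sumr_ge0 => i _; have [->|di] := weight_eq0_or_gt0 i.
  by rewrite expr2 !mul0r.
by rewrite divr_ge0 ?sqr_ge0// ltW ?xd.
Qed.

Lemma secular_surj m0 l : 0 < q -> admissible m0 -> secular m0 < l ->
  exists2 x, m0 < x & secular x = l.
Proof.
(* The second argument of the maximum makes the lower bound [secular_ge] at [b] at least [l]; the
   first keeps [b] to the right of [m0]. *)
move=> q0 m0d m0l; pose b := Num.max m0 (l + q^-1 * \sum_i d i).
have m0b : m0 <= b by rewrite le_max lexx.
have lb : l <= secular b.
  apply: le_trans (secular_ge q0 (admissible_le m0b m0d)).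
  by rewrite lerBrDr le_max lexx orbT.
have [||c] := @IVT R secular m0 b l m0b.
- apply: continuous_in_subspaceT => x.
  rewrite inE/= in_itv/= => /andP[ax _].
  by apply: secular_continuous; exact: admissible_le m0d.
- by rewrite ge_min (ltW m0l)/= le_max lb orbT.
rewrite in_itv/= => /andP[ac _] cl; exists c => //.
by rewrite lt_neqAle ac andbT; apply: contraTneq m0l => ->; rewrite cl ltxx.
Qed.

Lemma secular_le x : 0 < q -> 0 <= x -> secular x <= x.
Proof.
move=> q0 x0; rewrite /secular -[leRHS]mulr1 ler_wpM2l// gerDl oppr_le0.
apply: mulr_ge0; first by rewrite invr_ge0 ltW.
apply: sumr_ge0 => i _.
by rewrite divr_ge0 ?addr_ge0.
Qed.

Lemma secular_asymptote x : 0 < q -> 0 < x ->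
  `|x - (secular x + q^-1 * \sum_i d i)| <= (q^-1 * \sum_i d i ^+ 2) / x.
Proof.
move=> q0 x0; have xd : admissible x by move=> i di; exact: addr_gt0.
rewrite secularE//; set t := q^-1 * _; set s := q^-1 * _.
have -> : x - (x - t + s + t) = - s by ring.
rewrite normrN ger0_norm; last first.
  apply: mulr_ge0; first by rewrite invr_ge0 ltW.
  apply: sumr_ge0 => i _.
  by rewrite divr_ge0 ?exprn_ge0// addr_ge0// ltW.
rewrite -mulrA; apply: ler_wpM2l; first by rewrite invr_ge0 ltW.
rewrite mulr_suml; apply: ler_sum => i _.
have [->|di] := weight_eq0_or_gt0 i; first by rewrite expr2 !mul0r.
by rewrite ler_wpM2l ?exprn_ge0// lef_pV2 ?posrE ?addr_gt0// lerDr ltW.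
Qed.

(** At 0 every ratio is 1, or 0 / 0 = 0 for a zero weight, so the sum counts the nonzero weights. *)
Lemma sqsum0 : sqsum 0 = (\sum_i (d i != 0%R))%N%:R.
Proof.
rewrite natr_sum; apply: eq_bigr => i _; rewrite addr0.
by have [->|di] := eqVneq (d i) 0; rewrite ?mul0r ?expr0n// divff// expr1n.
Qed.

End SecularFunction.

(** * Continuity of the complex embedding and rank of diagonal matrices *)

Lemma real_complex_continuous {R : realType} :
  continuous (real_complex R : R -> (R[i] : numFieldType)).
Proof.
move=> x; apply/cvgrPdist_lt => -[e e'] /=.
(* A positive element of [R[i]] has zero imaginary part, so the radius is real. *)
rewrite ltcE/= => /andP[/eqP -> e0]; near=> y.
rewrite -rmorphB normc_def/= expr0n addr0 sqrtr_sqr ltcR.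
by near: y; exact: (@cvgr_dist_lt _ _ _ (nbhs x) _ id).
Unshelve. all: by end_near. Qed.

(** The row space is the direct sum of the lines spanned by the unit vectors at the nonzero
    entries. *)
Lemma mxrank_diag {F : fieldType} {n} (v : 'rV[F]_n) :
  \rank (diag_mx v) = (\sum_i (v 0%R i != 0%R))%N.
Proof.
have /eqmx_rank -> : (diag_mx v ==
    \sum_(i | v 0 i != 0) <<delta_mx 0 i : 'rV[F]_n>>)%MS.
  apply/andP; split.
    apply/row_subP => i; rewrite row_diag_mx.
    have [->|vi] := eqVneq (v 0 i) 0; first by rewrite scale0r sub0mx.
    by apply: scalemx_sub; rewrite (sumsmx_sup i)// genmxE.
  apply/sumsmx_subP => i vi; rewrite genmxE.
  by rewrite -[delta_mx _ _](scalerK vi) -row_diag_mx scalemx_sub// row_sub.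
rewrite (mxdirectP (mxdirect_delta _ _))//= [RHS]big_mkcond/= big_mkcond/=.
by apply: eq_bigr => i _; rewrite mxrank_gen mxrank_delta; case: (_ != _).
Qed.

(** * Calculus of matrices diagonalized by a common change of basis *)

Section Diagonalized.
Context {R : realType} {p : nat} (P : 'M[R[i]]_p) (P_unit : P \in unitmx).

(** For fixed [P], a real functional calculus: sums, products and inverses of these matrices act
    pointwise on [f], while trace, rank and real eigenvalues are read off [f]. *)
Definition diag_conj (f : 'I_p -> R) : 'M[R[i]]_p :=
  invmx P *m diag_mx (\row_i (f i)%:C) *m P.

Lemma diag_conj_scalar x : diag_conj (fun=> x) = (x%:C)%:M.
Proof.
rewrite /diag_conj (_ : \row__ _ = const_mx x%:C).
  by rewrite diag_const_mx mul_mx_scalar -scalemxAl mulVmx// scalemx1.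
by apply/rowP => i; rewrite !mxE.
Qed.

Lemma diag_conjD f g :
  diag_conj f + diag_conj g = diag_conj (fun i => f i + g i).
Proof.
rewrite /diag_conj -mulmxDl -mulmxDr -raddfD/=; congr (_ *m diag_mx _ *m _).
by apply/rowP => i; rewrite !mxE rmorphD.
Qed.

Lemma diag_conjM f g :
  diag_conj f *m diag_conj g = diag_conj (fun i => f i * g i).
Proof.
rewrite /diag_conj !mulmxA mulmxK//; congr (_ *m _).
rewrite -mulmxA mulmx_diag; congr (_ *m diag_mx _).
by apply/rowP => i; rewrite !mxE rmorphM.
Qed.

Lemma unitmx_diag_conj f : (diag_conj f \in unitmx) = [forall i, f i != 0].
Proof.
rewrite /diag_conj !unitmx_mul unitmx_inv P_unit andbT/= unitmxE det_diag.
rewrite unitfE; apply/prodf_neq0/forallP => H i => [|_]; move: (H i).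
  by rewrite mxE (inj_eq (@complexI _) _ 0) => ->.
by rewrite mxE (inj_eq (@complexI _) _ 0).
Qed.

Lemma invmx_diag_conj f : diag_conj f \in unitmx ->
  invmx (diag_conj f) = diag_conj (fun i => (f i)^-1).
Proof.
move=> fu; apply: (can_inj (mulKmx fu)); rewrite mulmxV// diag_conjM.
rewrite -[1%:M](diag_conj_scalar 1); congr diag_conj.
apply/funext => i; rewrite mulfV//.
by move: fu; rewrite unitmx_diag_conj => /forallP.
Qed.

Lemma mxtrace_diag_conj f : \tr (diag_conj f) = (\sum_i f i)%:C.
Proof.
rewrite /diag_conj mxtrace_mulC mulmxA mulmxV// mul1mx mxtrace_diag rmorph_sum.
by apply: eq_bigr => i _; rewrite mxE.
Qed.

Lemma mxrank_diag_conj f : \rank (diag_conj f) = (\sum_i (f i != 0%R))%N.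
Proof.
rewrite /diag_conj mxrankMfree ?row_free_unit// eqmxMfull; last first.
  by rewrite row_full_unit unitmx_inv.
rewrite mxrank_diag; apply: eq_bigr => i _.
by rewrite mxE (inj_eq (@complexI _) _ 0).
Qed.

Lemma eigenvalue_diag_conj f x :
  eigenvalue (diag_conj f) x%:C = [exists i, f i == x].
Proof.
rewrite /eigenvalue/= /eigenspace kermx_eq0 row_free_unit.
rewrite -diag_conj_scalar.
have -> : diag_conj f - diag_conj (fun=> x) = diag_conj (fun i => f i - x).
  by rewrite -[LHS]addr0; apply/eqP; rewrite addr0 subr_eq diag_conjD;
    apply/eqP; congr diag_conj; apply/funext => i; rewrite subrK.
rewrite unitmx_diag_conj negb_forall; apply: eq_existsb => i.
by rewrite negbK subr_eq0.
Qed.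

Lemma diag_conj_cvg {T} (F : set_system T) {FF : Filter F}
    (g : 'I_p -> T -> R) (f : 'I_p -> R) :
  (forall i, g i @ F --> f i) ->
  (diag_conj (fun i => g i y) : 'M[R[i] : numFieldType]_p) @[y --> F] -->
  (diag_conj f : 'M[R[i] : numFieldType]_p).
Proof.
move=> gf.
(* A linear combination of fixed matrices, so convergence of the coefficients suffices. *)
have E h : diag_conj h =
    \sum_i (h i)%:C *: (invmx P *m diag_mx (delta_mx 0 i) *m P).
  rewrite /diag_conj (_ : \row__ _ = \sum_i (h i)%:C *: delta_mx 0 i).
    rewrite linear_sum/= mulmx_sumr mulmx_suml; apply: eq_bigr => i _.
    by rewrite linearZ/= -scalemxAr -scalemxAl.
  by rewrite [LHS]row_sum_delta; apply: eq_bigr => i _; rewrite mxE.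
under eq_fun do rewrite E.
rewrite E; apply: cvg_big => [|i _]; first exact: add_continuous.
apply: cvgZr_tmp.
by apply: continuous_cvg (gf i); exact: real_complex_continuous.
Qed.

End Diagonalized.

(** * Spectral decomposition and resolvent of a positive semidefinite matrix *)

Lemma psdmx_diag_conj {R : realType} {p} (A : 'M[R[i]]_p) : psdmx A ->
  exists (P : 'M[R[i]]_p) (d : 'I_p -> R),
    [/\ P \in unitmx, forall i, 0 <= d i & A = diag_conj P d].
Proof.
move=> [Aherm Apsd].
have [P [D [Pu PV AE]]] : exists (P : 'M[R[i]]_p) (D : 'rV[R[i]]_p),
    [/\ P \in unitmx, (invmx P ^t*)%sesqui = P & A = invmx P *m diag_mx D *m P].
  exists (spectralmx A), (spectral_diag A); split.
  - exact: spectral_unit.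
  - by rewrite invmx_unitary ?spectral_unitarymx// trmxCK.
  - exact/orthomx_spectralP/hermitian_normalmx.
have D_ge0 i : 0 <= D 0 i.
  (* The columns of [invmx P] are orthonormal eigenvectors, so the quadratic form evaluated on them
     returns the entries of [D]. *)
  have := Apsd (col i (invmx P)).
  have -> : (col i (invmx P) ^t*)%sesqui = row i P by rewrite tr_col map_row PV.
  have -> : (row i P *m A *m col i (invmx P)) 0 0 = (P *m A *m invmx P) i i.
    by rewrite -row_mul !mxE; apply: eq_bigr => j _; rewrite !mxE.
  by rewrite AE -!mulmxA mulmxV// mulmx1 mulKVmx// mxE eqxx.
exists P, (fun i => complex.Re (D 0 i)); split=> // [i|].
  by have := D_ge0 i; rewrite lecE => /andP[].
rewrite AE /diag_conj; congr (_ *m diag_mx _ *m _).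
by apply/rowP => i; rewrite mxE RRe_real// ger0_real.
Qed.

(** Where the shifted matrix is singular, the value is a limit over a punctured neighbourhood; there
    the shifted matrix is invertible and every ratio converges by continuity at an admissible
    point. *)
Lemma resolvent_mul_diag_conj {R : realType} {p} (P : 'M[R[i]]_p)
    (d : 'I_p -> R) x :
  P \in unitmx -> (forall i, 0 <= d i) -> admissible d x ->
  resolvent_mul (diag_conj P d) x = diag_conj P (fun i => d i / (d i + x)).
Proof.
move=> Pu d0 xd; rewrite /resolvent_mul.
have E y : diag_conj P d + y%:C%:M \in unitmx ->
    diag_conj P d *m invmx (diag_conj P d + y%:C%:M) =
    diag_conj P (fun i => d i / (d i + y)).
  rewrite -(diag_conj_scalar Pu) diag_conjD => u.
  by rewrite invmx_diag_conj// diag_conjM.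
case: ifPn => [/E//|Nu].
apply: (@cvg_lim 'M[R[i] : numFieldType]_p); first exact: norm_hausdorff.
(* An admissible shift keeps positive eigenvalues positive, so singularity can only come from a zero
   eigenvalue shifted by 0. *)
have x0 : x = 0.
  move: Nu; rewrite -(diag_conj_scalar Pu) diag_conjD unitmx_diag_conj//.
  rewrite negb_forall => /existsP[k]; rewrite negbK.
  have [->|/xd/gt_eqF->//] := weight_eq0_or_gt0 d0 k.
  by rewrite add0r => /eqP.
have term_cvg i : d i / (d i + y) @[y --> x^'] --> d i / (d i + x).
  by apply: cvg_within_filter; exact: ratio_continuous.
apply: cvg_trans (diag_conj_cvg (P := P) term_cvg).
apply: near_eq_cvg; near=> y.
rewrite E// -(diag_conj_scalar Pu) diag_conjD unitmx_diag_conj//.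
apply/forallP => i.
have yd : admissible d y by near: y; apply: nbhs_dnbhs; exact: near_admissible.
have [->|/yd/gt_eqF->//] := weight_eq0_or_gt0 d0 i.
by rewrite add0r -x0; near: y; exact: nbhs_dnbhs_neq.
Unshelve. all: by end_near. Qed.

(** * Translation of [mu0], [lambda0] and [mu] into scalar equations *)

Section DiagonalizedMu.
Context {R : realType} {p : nat} (P : 'M[R[i]]_p) (d : 'I_p -> R) (q : R).
Context (P_unit : P \in unitmx) (d_ge0 : forall i, 0 <= d i) (q_gt0 : 0 < q).
Context (i0 : 'I_p) (di0_gt0 : 0 < d i0).
Let A := diag_conj P d.

Lemma lambda_min_pos_diag_conj : exists i,
  [/\ 0 < d i, lambda_min_pos A = d i & forall j, 0 < d j -> d i <= d j].
Proof.
have [i di_gt0 i_min] := @arg_minP _ _ _ i0 (fun i => 0 < d i) d di0_gt0.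
have posE l : positive_eigenvalues A l <-> exists2 j, 0 < d j & d j = l.
  rewrite /positive_eigenvalues/= /A eigenvalue_diag_conj//; split.
    by move=> [l0 /existsP[j /eqP jl]]; exists j; rewrite ?jl.
  by move=> [j dj jl]; rewrite -jl; split => //; apply/existsP; exists j.
exists i; split => //; apply: get_unique.
  split; first by apply/posE; exists i.
  by move=> _ /posE[j dj <-]; exact: i_min.
move=> l [/posE[j dj <-] lb]; apply/eqP; rewrite eq_le i_min// andbT.
by apply: lb; apply/posE; exists i.
Qed.

(** The solution provided by [sqsum_surj] guarantees that [get] returns a solution; injectivity of
    the embedding of [R] brings the complex equation down to the reals. *)
Lemma mu0_diag_conj : admissible d (mu0 A q) /\ sqsum d (mu0 A q) = q.
Proof.
have [i [di lE i_min]] := lambda_min_pos_diag_conj.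
have adm m : - lambda_min_pos A < m -> admissible d m.
  by rewrite lE => lm j /i_min; lra.
have eqE m : admissible d m ->
    1 = (q%:C)^-1 * \tr (resolvent_mul A m *m resolvent_mul A m) <->
    sqsum d m = q.
  move=> md; rewrite resolvent_mul_diag_conj// diag_conjM// mxtrace_diag_conj//.
  rewrite -fmorphV -rmorphM/= -[1](rmorph1 (real_complex R)).
  rewrite -/(sqsum d m); split => [/complexI|->]; last by rewrite mulVf ?gt_eqF.
  by move/(congr1 ( *%R q)); rewrite mulr1 mulVKf ?gt_eqF.
have [|m mgt mq] := sqsum_surj d_ge0 di0_gt0 q_gt0 i_min di; first by exists i.
have [] : [set m : R | - lambda_min_pos A < m /\
    1 = (q%:C)^-1 * \tr (resolvent_mul A m *m resolvent_mul A m)] (mu0 A q).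
  apply: getPex; exists m; split; first by rewrite lE.
  by apply/eqE => //; apply: adm; rewrite lE.
by move=> /adm ad e; split=> //; exact/(eqE _ ad).
Qed.

Lemma lambda_eq_diag_conj l m : admissible d m ->
  lambda_eq A q l m <-> secular d q m = l.
Proof.
move=> md; rewrite /lambda_eq resolvent_mul_diag_conj// mxtrace_diag_conj//.
rewrite -fmorphV -rmorphM/= -[1](rmorph1 (real_complex R)) -rmorphB -rmorphM.
by split => [/complexI ->|<-].
Qed.

Lemma lambda0_diag_conj : lambda0 A q = secular d q (mu0 A q).
Proof.
have [ad _] := mu0_diag_conj; apply: get_unique.
  exact/lambda_eq_diag_conj.
by move=> l /lambda_eq_diag_conj ->.
Qed.

(** Surjectivity of [secular] to the right of [mu0] supplies the witness behind [get]. *)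
Lemma mu_diag_conj l : lambda0 A q < l ->
  mu0 A q < mu A q l /\ secular d q (mu A q l) = l.
Proof.
have [ad _] := mu0_diag_conj.
rewrite lambda0_diag_conj => /(secular_surj d_ge0 q_gt0 ad)[m mgt ml].
have adm x : mu0 A q < x -> admissible d x by move/ltW/admissible_le; apply.
have [] : [set m : R | mu0 A q < m /\ lambda_eq A q l m] (mu A q l).
  apply: getPex; exists m; split => //.
  by apply/lambda_eq_diag_conj => //; exact: adm.
move=> mu_gt e; split => //.
by apply/lambda_eq_diag_conj => //; exact: adm.
Qed.

End DiagonalizedMu.

(** * Concavity, bounds and asymptotics of [mu] *)

Theorem proposition5p5 (R : realType) (p : nat) (A : 'M[R[i]]_p) (q alpha : R)
    (A_neq0 : A != 0) (A_psd : psdmx A)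
    (alpha_def : alpha = q / p%:R) (alpha_gt0 : 0 < alpha) :
  [/\ concave_function `]lambda0 A q, +oo[ (mu A q),
      forall l : R, lambda0 A q < l ->
        mu A q l <= l + q^-1 * complex.Re (\tr A),
      alpha <= rank_ratio A ->
        forall l : R, lambda0 A q < l -> l <= mu A q l,
      ~~ (alpha <= rank_ratio A) ->
        forall l : R, 0 <= l -> l <= mu A q l
    & `|mu A q l - (l + q^-1 * complex.Re (\tr A))| @[l --> +oo] --> (0 : R)].
Proof.
have [P [d [P_unit d_ge0 AE]]] := psdmx_diag_conj A_psd.
have p_gt0 : (0 < p)%N.
  case: p A A_neq0 {A_psd alpha_def P d P_unit d_ge0 AE} => // A /eqP[].
  exact: flatmx0.
have q_gt0 : 0 < q.
  by move: alpha_gt0; rewrite alpha_def pmulr_lgt0 ?invr_gt0 ?ltr0n.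
have [i0 di0] : exists i, 0 < d i.
  apply/existsP; apply: contraNT A_neq0; rewrite negb_exists => /forallP d0.
  have -> : A = diag_conj P (fun=> 0).
    rewrite AE; congr diag_conj; apply/funext => i.
    by case: (weight_eq0_or_gt0 d_ge0 i) => // di; have := d0 i; rewrite di.
  by rewrite diag_conj_scalar// rmorph0.
have trE : complex.Re (\tr A) = \sum_i d i by rewrite AE mxtrace_diag_conj.
have rankE : rank_ratio A = sqsum d 0 / p%:R.
  by rewrite /rank_ratio AE mxrank_diag_conj// sqsum0.
have := mu0_diag_conj P_unit d_ge0 q_gt0 di0.
have := mu_diag_conj P_unit d_ge0 q_gt0 di0.
have := lambda0_diag_conj P_unit d_ge0 q_gt0 di0.
(* From here on the matrix enters only through its weights: [mu] is an abstract right inverse of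
   [secular] with values beyond [m0]. *)
rewrite -AE trE; move: (mu0 A q) (lambda0 A q) (mu A q).
move=> m0 _ mu -> muP [m0d m0q].
have muP1 l : secular d q m0 < l -> m0 < mu l by case/muP.
have muP2 l : secular d q m0 < l -> secular d q (mu l) = l by case/muP.
have adm x : m0 <= x -> admissible d x by move/admissible_le; apply.
have sec_lt x y : m0 <= x -> x < y -> secular d q x < secular d q y.
  exact: (secular_lt d_ge0 di0 q_gt0 m0d m0q).
have sec_le x y : m0 <= x -> m0 <= y ->
    secular d q x <= secular d q y -> x <= y.
  by move=> mx my; apply: contraTT; rewrite -!ltNge; exact: sec_lt.
have mu_ge l : secular d q m0 < l -> 0 <= mu l -> l <= mu l.
  by move=> l0 mu_ge0; rewrite -[leLHS]muP2// secular_le.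
have sec0 : secular d q 0 = 0 by rewrite /secular mul0r.
have qr : (alpha <= rank_ratio A) = (0 <= m0).
  rewrite rankE alpha_def ler_pM2r ?invr_gt0 ?ltr0n// -m0q.
  have d0 : admissible d 0 by move=> i; rewrite addr0.
  case: (ltgtP 0 m0) => [m0_gt0|m0_lt0|<-]; last by rewrite lexx.
    by rewrite ltW// (sqsum_lt d_ge0 di0).
  by rewrite leNgt (sqsum_lt d_ge0 di0 m0d m0_lt0).
split.
- move=> t x y; rewrite !inE/= !in_itv/= !andbT => lx ly.
  have t01 : 0 <= t%:num <= 1 by rewrite ge0 le1.
  change (- mu (t%:num * x + (1 - t%:num) * y) <=
    t%:num * - mu x + (1 - t%:num) * - mu y).
  rewrite !mulrN -opprD lerN2; move: (t%:num) t01 => {}t t01.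
  have conv_ge a b c : c <= a -> c <= b -> c <= t * a + (1 - t) * b.
    by move: t01 => /andP[t0 t1] ca cb; nra.
  have conv_gt a b c : c < a -> c < b -> c < t * a + (1 - t) * b.
    move=> ca cb; have /lt_le_trans : c < Num.min a b by rewrite lt_min ca.
    by apply; apply: conv_ge; rewrite ge_min lexx ?orbT.
  have lz := conv_gt _ _ _ lx ly.
  (* Since [secular] reflects the order beyond [m0], the images are compared instead; there the
     claim is convexity of [secular] at [mu x] and [mu y]. *)
  apply: sec_le; last first.
  - rewrite muP2// -[in leRHS](muP2 _ lx) -[in leRHS](muP2 _ ly).
    by apply: secular_convex => //; [exact: ltW| |]; exact/adm/ltW/muP1.
  - exact/ltW/muP1.
  - by apply: conv_ge; exact/ltW/muP1.
- move=> l ll; rewrite -{2}[l]muP2// -lerBlDr; apply: secular_ge => //.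
  exact/adm/ltW/muP1.
- rewrite qr => m0_ge0 l ll; apply: mu_ge => //.
  exact: le_trans (ltW (muP1 _ ll)).
- rewrite qr -ltNge => m0_lt0 l l_ge0.
  (* A negative [m0] gives [secular m0 < secular 0 = 0], so every [l >= 0] lies in the domain. *)
  have ll : secular d q m0 < l.
    by apply: lt_le_trans l_ge0; rewrite -sec0 sec_lt.
  apply: mu_ge => //; apply: sec_le (ltW m0_lt0) (ltW (muP1 _ ll)) _.
  by rewrite sec0 muP2.
- apply/cvgrPdist_le => e e_gt0; near=> l.
  have ll : secular d q m0 < l.
    by near: l; apply: nbhs_pinfty_gt; exact: num_real.
  have mu_gt0 : 0 < mu l.
    (* Once [l] exceeds this value, monotonicity forces [mu l] past both [m0] and 0. *)
    have lm : secular d q (Num.max m0 0) < l.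
      by near: l; apply: nbhs_pinfty_gt; exact: num_real.
    apply: (@le_lt_trans _ _ (Num.max m0 0)); first by rewrite le_max lexx orbT.
    rewrite ltNge; apply: contraTN lm => mul; rewrite -leNgt -(muP2 _ ll).
    move: mul; rewrite le_eqVlt => /predU1P[->//|max_gt].
    exact/ltW/sec_lt/max_gt/ltW/muP1.
  have := secular_asymptote d_ge0 q_gt0 mu_gt0; rewrite muP2//.
  rewrite sub0r normrN normr_id => /le_trans; apply.
  set c := q^-1 * _.
  (* The error bound [c / mu l] is at most [e] as soon as [c / e <= l], because [l <= mu l]. *)
  rewrite ler_pdivrMr// mulrC -ler_pdivrMr//.
  apply: le_trans (mu_ge _ ll (ltW mu_gt0)).
  by near: l; apply: nbhs_pinfty_ge; exact: num_real.
Unshelve. all: by end_near. Qed.
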